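(* Let $n\geq 4$ be an integer not divisible by $5$. If $n$ has an odd prime divisor $p \neq 3$, then $B_2(C_n)=4$.
   Context: $C_n$ is the cycle with vertex set $\mathbb{Z}_n=\{0,1,\dots,n-1\}$, $i$ adjacent to $i\pm1 \pmod n$; the graph distance is $\mathrm{dist}(i,j)=\min(|i-j|,\,n-|i-j|)$. For a set $D$ of positive integers, the distance graph $G(C_n,D)$ has vertex set $\mathbb{Z}_n$, with distinct $i,j$ adjacent iff $\mathrm{dist}(i,j)\in D$; $\chi(C_n,D)$ is its chromatic number. $B_2(C_n)=\max\{\chi(C_n,D): D\subseteq\{1,\dots,\lfloor n/2\rfloor\},\ |D|=2\}$. *)

(* Defs.v *)
From HB Require Import structures.
From mathcomp Require Import all_boot.

Set Implicit Arguments.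
Unset Strict Implicit.
Unset Printing Implicit Defensive.

Record sgraph (V : finType) := SGraph {
  adj :> rel V;
  adj_sym : symmetric adj;
  adj_irr : irreflexive adj
}.

Definition proper_coloring (V : finType) (G : sgraph V) (k : nat)
    (f : {ffun V -> 'I_k}) : bool :=
  [forall x, forall y, G x y ==> (f x != f y)].

Definition colorable (V : finType) (G : sgraph V) (k : nat) : bool :=
  [exists f : {ffun V -> 'I_k}, proper_coloring G f].

Lemma ex_colorable (V : finType) (G : sgraph V) : exists k, colorable G k.
Proof.
exists #|V|; apply/existsP; exists [ffun x => enum_rank x].
apply/forallP => x; apply/forallP => y; apply/implyP => Gxy.
rewrite !ffunE; apply: contraTneq Gxy => /enum_rank_inj ->.
by rewrite adj_irr.
Qed.

Definition chromatic_number (V : finType) (G : sgraph V) : nat :=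
  ex_minn (ex_colorable G).

(* ssrnat subtraction is truncated, so one of the two summands is 0. *)
Definition absdiff (i j : nat) : nat := (i - j) + (j - i).

Definition cycle_dist (n : nat) (i j : 'I_n) : nat :=
  minn (absdiff i j) (n - absdiff i j).

Definition dist_adj (n : nat) (D : {pred nat}) : rel 'I_n :=
  fun i j => (i != j) && (cycle_dist i j \in D).

Lemma dist_adj_sym (n : nat) (D : {pred nat}) : symmetric (@dist_adj n D).
Proof.
by move=> i j; rewrite /dist_adj /cycle_dist /absdiff eq_sym (addnC (i - j)).
Qed.

Lemma dist_adj_irr (n : nat) (D : {pred nat}) : irreflexive (@dist_adj n D).
Proof. by move=> i; rewrite /dist_adj eqxx. Qed.

Definition dist_graph (n : nat) (D : {pred nat}) : sgraph 'I_n :=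
  SGraph (@dist_adj_sym n D) (@dist_adj_irr n D).

Definition chi (n : nat) (D : {pred nat}) : nat :=
  chromatic_number (dist_graph n D).

(* D ranges over the 2-element subsets of {1, .., n./2}, encoded as subsets of
   {0, .., n./2} that avoid 0.  The maximum is over a nonempty family as soon
   as 4 <= n (for n < 4 it is the default value 0). *)
Definition B2 (n : nat) : nat :=
  \max_(D : {set 'I_(n./2).+1} |
         (D \subset [set d : 'I_(n./2).+1 | 0 < d]) && (#|D| == 2))
    chi n [in [seq val d | d in D]].

(* Main.v *)
Require Import Defs.
From mathcomp Require Import all_boot.
From mathcomp Require Import zify.

(** Upper bound: a proper 4-colouring of the circulant graph with steps a, b on
    Z_n.  If a and b both have even order, each step class is bipartite and the
    product of two 2-colourings works.  Otherwise let a, say, have odd order L,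
    and let g = gcd(a, n), where gcd(a, b, n) = 1 without loss of generality.  If
    g > 1, the graph consists of g rows, the cosets of <a>, which are cycles of
    length L arranged cyclically by b: colour all rows but one by shifts of a
    3-colouring of the cycle, and complete the last row from lists of size two.
    If g = 1, multiplying by the inverse of a makes a = 1 and n is odd: explicit
    colourings for b = 1 and b = 2 (the latter fails exactly for n = 5), and a
    greedy colouring in the style of Brooks' theorem for b >= 3.

    Lower bound: with n = p m, p >= 7 prime, three colours do not suffice for
    D = {m, 2m}. *)

Set Implicit Arguments.
Unset Strict Implicit.
Unset Printing Implicit Defensive.

(* Colourings of Z_n are encoded as n-periodic functions on nat. *)
Definition cyc_colorable (n a b : nat) : Prop :=
  exists f : nat -> nat, [/\ forall x, f x < 4, forall x, f (x + n) = f x,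
    forall x, f (x + a) <> f x & forall x, f (x + b) <> f x].

(** * Periodic functions and reductions between pairs of steps *)

Lemma periodic_mod (f : nat -> nat) n :
  (forall x, f (x + n) = f x) -> forall x y, x = y %[mod n] -> f x = f y.
Proof.
move=> fn x y; suff fE z : f z = f (z %% n) by move=> E; rewrite fE E -fE.
rewrite {1}(divn_eq z n) addnC; elim: (z %/ n) => [|k IHk]; first by rewrite addn0.
by rewrite mulSn [n + _]addnC addnA fn.
Qed.

Lemma cyc_colorableC n a b : cyc_colorable n a b -> cyc_colorable n b a.
Proof. by case=> f [? ? ? ?]; exists f. Qed.

Lemma cyc_colorable_mod n a b a' b' :
  a = a' %[mod n] -> b = b' %[mod n] ->
  cyc_colorable n a b -> cyc_colorable n a' b'.
Proof.
move=> Ea Eb [f [f4 fn fa fb]]; exists f; split=> // x.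
  rewrite -(periodic_mod fn (x := x + a)) //.
  by apply/eqP; rewrite eqn_modDl; apply/eqP.
rewrite -(periodic_mod fn (x := x + b)) //.
by apply/eqP; rewrite eqn_modDl; apply/eqP.
Qed.

(** Pull back along multiplication by [u]; taking [u] inverse to [a] normalises the first step to
    1. *)
Lemma cyc_colorable_mul u n a b :
  cyc_colorable n (u * a) (u * b) -> cyc_colorable n a b.
Proof.
move=> [f [f4 fn fa fb]]; exists (fun x => f (u * x)).
split=> [x|x|x|x]; rewrite ?mulnDr //.
by apply: (periodic_mod fn); rewrite addnC modnMDl.
Qed.

Lemma cyc_colorable_opp n a b :
  b <= n -> cyc_colorable n a (n - b) -> cyc_colorable n a b.
Proof.
move=> bn [f [f4 fn fa fb]]; exists f; split=> // x.
by have := fb (x + b); rewrite -addnA subnKC // fn => h /esym.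
Qed.

(** The residue classes modulo [d] are disjoint copies of the smaller graph, and [x %/ d] is the
    position of [x] in its copy. *)
Lemma cyc_colorable_scale d n a b : 0 < d ->
  cyc_colorable n a b -> cyc_colorable (d * n) (d * a) (d * b).
Proof.
move=> d0 [f [f4 fn fa fb]]; exists (fun x => f (x %/ d)).
by split=> [x|x|x|x]; rewrite // addnC mulnC divnMDl // addnC.
Qed.

(** For colourings given on [0 .. n - 1] only: the four alternatives are the edges inside this
    window and those that wrap around. *)
Lemma cyc_colorable_window n a b (f : nat -> nat) :
  (forall x, f x < 4) -> 0 < n -> a <= n -> b <= n ->
  (forall x y, x < n -> y < n ->
     [\/ y = x + a, y + n = x + a, y = x + b | y + n = x + b] -> f x <> f y) ->
  cyc_colorable n a b.
Proof.
move=> f4 n0 an bn fP; exists (fun x => f (x %% n)).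
split=> [x|x|x|x]; rewrite ?f4 ?modnDr //.
- apply: nesym; apply: fP; rewrite ?ltn_mod // -modnDml.
  have := ltn_pmod x n0; move: (x %% n) => r rn.
  have [h|h] := ltnP (r + a) n; first by rewrite modn_small //; constructor 1.
  have -> : (r + a) %% n = r + a - n.
    by rewrite -[in LHS](subnK h) modnDr modn_small //; lia.
  by constructor 2; lia.
- apply: nesym; apply: fP; rewrite ?ltn_mod // -modnDml.
  have := ltn_pmod x n0; move: (x %% n) => r rn.
  have [h|h] := ltnP (r + b) n; first by rewrite modn_small //; constructor 3.
  have -> : (r + b) %% n = r + b - n.
    by rewrite -[in LHS](subnK h) modnDr modn_small //; lia.
  by constructor 4; lia.
Qed.


(** * Colour choices and colourings of odd cycles *)

Lemma avoid3 (x y z : nat) : exists c, [/\ c < 4, c <> x, c <> y & c <> z].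
Proof.
have : [\/ [/\ 0 <> x, 0 <> y & 0 <> z], [/\ 1 <> x, 1 <> y & 1 <> z],
          [/\ 2 <> x, 2 <> y & 2 <> z] | [/\ 3 <> x, 3 <> y & 3 <> z]].
  have : (0 <> x /\ 0 <> y /\ 0 <> z) \/ (1 <> x /\ 1 <> y /\ 1 <> z) \/
         (2 <> x /\ 2 <> y /\ 2 <> z) \/ (3 <> x /\ 3 <> y /\ 3 <> z) by lia.
  by case=> [|[|[|]]] [? [? ?]]; [constructor 1|constructor 2|constructor 3|constructor 4].
by case=> [[? ? ?]|[? ? ?]|[? ? ?]|[? ? ?]]; [exists 0|exists 1|exists 2|exists 3].
Qed.

Definition avoid2 (x y : nat) : nat :=
  if (0 != x) && (0 != y) then 0 else if (1 != x) && (1 != y) then 1 else 2.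

Lemma avoid2P x y : [/\ avoid2 x y < 3, avoid2 x y <> x & avoid2 x y <> y].
Proof. by rewrite /avoid2; do ! case: ifP; split; lia. Qed.

Definition odd_cycle_color (L i : nat) : nat :=
  if i %% L == L.-1 then 2 else odd (i %% L).

Lemma modn_succ i L : 0 < L ->
  i.+1 %% L = if (i %% L).+1 == L then 0 else (i %% L).+1.
Proof.
move=> L0; have := ltn_pmod i L0; rewrite -[i.+1]addn1 -modnDml addn1.
move: (i %% L) => k kL; case: eqP => [->|]; first by rewrite modnn.
by move=> ?; rewrite modn_small //; lia.
Qed.

Lemma odd_cycle_color_lt L i : odd_cycle_color L i < 3.
Proof. by rewrite /odd_cycle_color; case: ifP => // _; case: odd. Qed.

Lemma odd_cycle_color_period L i : odd_cycle_color L (i + L) = odd_cycle_color L i.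
Proof. by rewrite /odd_cycle_color modnDr. Qed.

Lemma odd_cycle_colorS L i : odd L -> 1 < L ->
  odd_cycle_color L i.+1 <> odd_cycle_color L i.
Proof.
move=> oL L1; rewrite /odd_cycle_color modn_succ; last lia.
have : i %% L < L by rewrite ltn_mod; lia.
move: (i %% L) => k kL; do ! case: eqP; lia.
Qed.

Lemma odd_cycle_color_onto L c : odd L -> 1 < L -> c < 3 ->
  exists i, odd_cycle_color L i = c.
Proof.
move=> oL L1; case: c => [|[|[|//]]] _; [exists 0|exists 1|exists L.-1];
  by rewrite /odd_cycle_color modn_small; [case: eqP; lia | lia].
Qed.

(* Colour 3 is free everywhere, so it can be used on every second vertex; since
   [p] takes all three values, the remaining choices are not constant, and the
   two adjacent vertices which parity forces to avoid colour 3 are placed where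
   these choices differ. *)
Lemma odd_cycle_avoid2 L (p q : nat -> nat) : odd L -> 1 < L ->
  (forall i, p i < 3) -> (forall i, q i < 3) ->
  (forall i, p (i + L) = p i) -> (forall i, q (i + L) = q i) ->
  (forall c, c < 3 -> exists i, p i = c) ->
  exists r : nat -> nat, [/\ forall i, r i < 4, forall i, r (i + L) = r i,
    forall i, r i.+1 <> r i, forall i, r i <> p i & forall i, r i <> q i].
Proof.
move=> oL L1 p3 q3 pL qL ponto; pose e i := avoid2 (p i) (q i).
have eP i : [/\ e i < 3, e i <> p i & e i <> q i] := avoid2P _ _.
have eL i : e (i + L) = e i by rewrite /e pL qL.
clearbody e.
have [|noi] := boolP [exists i : 'I_L, e i != e i.+1]; last first.
  (* If [e] were constant, [p] would never take the value [e 0], since [e] avoids [p] everywhere. *)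
  have eS i : e i.+1 = e i.
    have iL : i %% L < L by rewrite ltn_mod; lia.
    have := noi; rewrite negb_exists => /forallP/(_ (Ordinal iL)).
    rewrite negbK /= => /eqP h.
    rewrite (periodic_mod eL (x := i) (y := i %% L)) ?modn_mod // h.
    by apply: (periodic_mod eL); rewrite -[in RHS]addn1 modnDml addn1.
  have e0 i : e i = e 0 by elim: i => // i; rewrite eS.
  have [e03 _ _] := eP 0; have [i pi] := ponto _ e03.
  by have [_ + _] := eP i; rewrite e0 pi.
case/existsP=> i0 /eqP ei0.
(* Positions are rotated so that [i0] sits at position 0. *)
pose k i := (i + (L - i0)) %% L.
have kL i : k i < L by rewrite ltn_mod; lia.
have kS i : k i.+1 = if (k i).+1 == L then 0 else (k i).+1.
  by rewrite /k addSn modn_succ //; lia.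
have k0 i : k i = 0 -> i = i0 %[mod L].
  move=> h; apply/eqP; rewrite -(eqn_modDr (L - i0)) -/(k i) h.
  by rewrite subnKC ?modnn // ltnW.
have kper i : k (i + L) = k i by rewrite /k addnAC modnDr.
clearbody k.
(* The last position [L - 1] is even and gets 3, so the only neighbours both coloured by [e] are
   positions 0 and 1, where [e] differs. *)
exists (fun i => if ~~ odd (k i) && (k i != 0) then 3 else e i).
split=> i.
- by case: ifP => // _; have [] := eP i; lia.
- by rewrite eL kper.
- rewrite kS; have := kL i; have [] := eP i; have [] := eP i.+1.
  have [ki|k1] := eqVneq (k i) 0; last first.
    by move: (k i) k1 => m m1; do ! case: ifP; lia.
  have ki0 := k0 _ ki; rewrite ki.
  have -> : e i = e i0 by apply: (periodic_mod eL).
  have -> : e i.+1 = e i0.+1.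
    by apply: (periodic_mod eL); rewrite -addn1 -modnDml ki0 modnDml addn1.
  have -> : (1 == L) = false by lia.
  by rewrite /= => _ _ _ _ _ _ _ /esym.
- by have [] := eP i; have := p3 i; case: ifP; lia.
- by have [] := eP i; have := q3 i; case: ifP; lia.
Qed.

(** * Cyclically arranged rows of odd length *)

(** All rows but the last alternate between a 3-colouring of the cycle and its colour shift by 1.
    The last row has to avoid row [g - 2] and row 0 displaced by the twist [s], which
    [odd_cycle_avoid2] achieves for any [s]. *)
Lemma twisted_grid_coloring L g s : odd L -> 1 < L -> 1 < g ->
  exists F : nat -> nat -> nat, [/\ forall j i, F j i < 4,
    forall j i, F j (i + L) = F j i, forall j i, F j i.+1 <> F j i,
    forall j i, j.+1 < g -> F j.+1 i <> F j i &
    forall i, F 0 (i + s) <> F g.-1 i].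
Proof.
move=> oL L1 g1; pose c := odd_cycle_color L.
pose G j i := (c i + odd j) %% 3.
have GL j i : G j (i + L) = G j i by rewrite /G /c odd_cycle_color_period.
have G3 j i : G j i < 3 by rewrite ltn_mod.
have GS j i : G j i.+1 <> G j i.
  have := @odd_cycle_colorS L i oL L1; rewrite /G /c.
  by have := odd_cycle_color_lt L i; have := odd_cycle_color_lt L i.+1; lia.
have GSj j i : G j.+1 i <> G j i.
  by have := odd_cycle_color_lt L i; rewrite /G /c /=; lia.
have Gonto j x : x < 3 -> exists i, G j i = x.
  move=> x3; have [i ci] : exists i, c i = (x + 3 - odd j) %% 3.
    by apply: odd_cycle_color_onto; rewrite // ltn_mod.
  by exists i; rewrite /G ci; lia.
have [|r [r4 rL rS rp rq]] := @odd_cycle_avoid2 L (G (g - 2)) (fun i => G 0 (i + s))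
  oL L1 (G3 _) (fun i => G3 _ _) (GL _) _ (Gonto _).
  by move=> i; rewrite addnAC GL.
exists (fun j i => if j < g.-1 then G j i else r i); split.
- by move=> j i; case: ifP => // _; have := G3 j i; lia.
- by move=> j i; rewrite GL rL.
- by move=> j i; case: ifP.
- move=> j i jg; case: ifP => h1; case: ifP => h2 //; try lia.
  have -> : j = g - 2 by lia.
  exact: rp.
- by move=> i; rewrite ltnn; case: ifP; [move=> _ /esym; apply: rq | lia].
Qed.

Lemma modn_inverse a n : 0 < n -> coprime a n -> exists k, k * a = 1 %[mod n].
Proof.
(* The Chinese remainder is 0 modulo [a] and 1 modulo [n], so its quotient by [a] is an inverse. *)
move=> n0 co; exists (chinese a n 0 1 %/ a).
have a_dvd : a %| chinese a n 0 1.
  by rewrite /dvdn chinese_modl // mod0n.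
by rewrite divnK // chinese_modr.
Qed.

Lemma eqn_modMr_coprime k m n d : coprime d k ->
  m * k = n * k %[mod d] -> m = n %[mod d].
Proof.
move=> co; wlog le_nm : m n / n <= m => [wl E|].
  by case/orP: (leq_total n m) => h; [|apply/esym]; apply: wl.
move=> /eqP; rewrite eqn_mod_dvd ?leq_mul // -mulnBl Gauss_dvdl // => h.
by apply/eqP; rewrite eqn_mod_dvd.
Qed.

(** Each [x] is [j * b + i * (g * a)] modulo [n] for a unique [j < g] and a unique [i] modulo [L].
    The step [g * a] moves along row [j], and [b] moves to the next row. *)
Lemma cyc_colorable_rows g L a b : odd L -> 1 < L -> 1 < g ->
  coprime a L -> coprime b g -> cyc_colorable (g * L) (g * a) b.
Proof.
move=> oL L1 g1 coa cob; set n := g * L.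
have [||ai aiP] := @modn_inverse a L; [lia|by []|].
have [||bi biP] := @modn_inverse b g; [lia|by []|].
(* Going once through all [g] rows returns to row 0 displaced by [s]. *)
pose s := b * ai.
have sP : s * (g * a) = g * b %[mod n].
  rewrite /n mulnCA -!muln_modr /s -mulnA -modnMmr aiP modnMmr muln1 //.
have [F [F4 FL FS FSj Fs]] := @twisted_grid_coloring L g s oL L1 g1.
have co_ex x : exists u : nat * nat,
    (u.1 < g) && (x == u.1 * b + u.2 * (g * a) %[mod n]).
  pose j := (x * bi) %% g.
  have jb : j * b = x %[mod g].
    by rewrite modnMml -mulnA -modnMmr biP modnMmr muln1.
  (* Modulo [n] this is [x - j * b], with [n.-1] playing the role of -1. *)
  pose y := x + j * b * n.-1.
  have n0 : 0 < n by rewrite muln_gt0; lia.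
  have gy : g %| y.
    rewrite /dvdn /y -modnDml -jb modnDml -mulnS prednK // -/(dvdn g _).
    by rewrite dvdn_mull ?dvdn_mulr.
  exists (j, (y %/ g) * ai) => /=; rewrite ltn_mod; apply/andP; split; first lia.
  have -> : y %/ g * ai * (g * a) = y %/ g * (ai * a) * g by lia.
  rewrite -modnDmr.
  have -> : y %/ g * (ai * a) * g = y %[mod n].
    rewrite /n [g * L]mulnC -muln_modl -modnMmr aiP modnMmr muln1 muln_modl divnK //.
  rewrite modnDmr /y; have -> : j * b + (x + j * b * n.-1) = (j * b) * n + x.
    by rewrite addnCA -mulnS prednK // addnC.
  by rewrite modnMDl.
have co_uniq j i j' i' : j < g -> j' < g ->
    j * b + i * (g * a) = j' * b + i' * (g * a) %[mod n] ->
    j = j' /\ i = i' %[mod L].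
  move=> jg j'g E.
  have Ej : j = j'.
    have : j = j' %[mod g].
      apply: (@eqn_modMr_coprime b); first by rewrite coprime_sym.
      have := congr1 (modn^~ g) E; rewrite !modn_dvdm ?dvdn_mulr //.
      by rewrite ![_ * (g * a)]mulnCA ![g * (_ * _)]mulnC ![_ + _ * g]addnC !modnMDl.
    by rewrite !modn_small.
  split=> //; apply: (@eqn_modMr_coprime a); first by rewrite coprime_sym.
  move/eqP: E; rewrite Ej eqn_modDl ![_ * (g * a)]mulnCA /n -!muln_modr eqn_pmul2l; last lia.
  by move/eqP.
pose f x := let u := xchoose (co_ex x) in F u.1 u.2.
have fE x j i : j < g -> x = j * b + i * (g * a) %[mod n] -> f x = F j i.
  move=> jg E; rewrite /f; have := xchooseP (co_ex x).
  case: (xchoose _) => j' i' /= /andP[j'g /eqP E'].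
  have [] := co_uniq j' i' j i j'g jg; first by rewrite -E'.
  by move=> ->; apply: periodic_mod.
have coord x : exists j i, [/\ j < g, f x = F j i & x = j * b + i * (g * a) %[mod n]].
  have [[j i] /= /andP[jg /eqP E]] := co_ex x.
  by exists j, i; split=> //; apply: fE.
exists f; split=> x.
- by have [j [i [_ -> _]]] := coord x.
- have [j [i [jg -> E]]] := coord x.
  by apply: fE => //; rewrite modnDr.
- have [j [i [jg -> E]]] := coord x.
  rewrite (@fE _ j i.+1) //.
  by rewrite -modnDml E modnDml -addnA -mulSnr.
- have [j [i [jg -> E]]] := coord x.
  have [jg1|jg1] := ltnP j.+1 g.
    by rewrite (@fE _ j.+1 i) //; [exact: FSj | rewrite -modnDml E modnDml addnAC -mulSnr].
  have jE : j = g.-1 by clear -jg jg1; lia.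
  rewrite jE (@fE _ 0 (i + s)) //; first by clear -g1; lia.
  rewrite -modnDml E jE modnDml mulnDl mul0n add0n -[in RHS]modnDmr sP modnDmr.
  by rewrite addnAC -mulSnr prednK ?[_ + g * b]addnC //; clear -g1; lia.
Qed.

(** * First step 1, or coprime to an odd [n] *)

Lemma cyc_colorable_1_1 n : odd n -> 1 < n -> cyc_colorable n 1 1.
Proof.
move=> on n1; exists (odd_cycle_color n); split=> x; rewrite ?addn1.
- by have := odd_cycle_color_lt n x; lia.
- exact: odd_cycle_color_period.
- exact: odd_cycle_colorS.
- exact: odd_cycle_colorS.
Qed.

(* Write n = 4y + 3z and concatenate y blocks 0123 and z blocks 012. *)
Lemma cyc_colorable_1_2 n : 5 < n -> cyc_colorable n 1 2.
Proof.
(* This choice makes [n - 4 * y] a multiple of 3, and it is nonnegative because [n > 5]. *)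
move=> n5; pose y := n %% 3.
apply: (@cyc_colorable_window n 1 2
  (fun x => if x < 4 * y then x %% 4 else (x - 4 * y) %% 3)); try lia.
- by move=> x; case: ifP; lia.
- move=> x z xn zn h.
  have {}h : z = x + 1 \/ z + n = x + 1 \/ z = x + 2 \/ z + n = x + 2.
    by case: h; tauto.
  by rewrite /y; do 2 case: ifP; lia.
Qed.

(* Brooks-style greedy colouring in the order 0, b - 1, 1, 2, .., n - 1: every
   vertex but the last has a later neighbour (namely x + 1, or x + b when
   x + 1 = b - 1), while the last one, n - 1, is adjacent to both 0 and b - 1,
   which are not adjacent to each other and have received the same colour. *)
Lemma cyc_colorable_1_ge3 n b : 2 < b -> b.*2 <= n -> cyc_colorable n 1 b.
Proof.
move=> b2 bn.
(* [S k] collects the vertices coloured so far; [b - 1] is coloured at the start together with 0. *)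
pose S k x := x <= k \/ x = b.-1.
pose e x y := y = x + 1 \/ y + n = x + 1 \/ y = x + b \/ y + n = x + b.
have greedy k : k < n -> exists f : nat -> nat,
    [/\ forall x, f x < 4, f 0 = f b.-1 &
    forall x y, x < n -> y < n -> S k x -> S k y -> e x y -> f x <> f y].
  elim: k => [|k IHk] kn.
    exists (fun=> 0); split=> // x y; rewrite /S /e; lia.
  have [f [f4 f0 fP]] := IHk (ltnW kn).
  have [kb|kb] := eqVneq k.+1 b.-1.
    by exists f; split=> // x y xn yn Sx Sy; apply: fP => //; rewrite /S in Sx Sy *; lia.
  have [c [c4 cP]] : exists c, c < 4 /\
      forall y, y < n -> S k y -> e y k.+1 \/ e k.+1 y -> c <> f y.
    (* These are [k + 1 - b] and [k + 1 + b] modulo [n], the neighbours of [k + 1] other than [k]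
       and its successor. Each case below leaves at most three colours to avoid. *)
    pose y1 := if b <= k.+1 then k.+1 - b else k.+1 + n - b.
    pose y2 := if k.+1 + b < n then k.+1 + b else k.+1 + b - n.
    have [kn1|kn1] := eqVneq k.+1 n.-1.
      have [c [c4 c1 c2 c3]] := avoid3 (f 0) (f k) (f (k.+1 - b)).
      exists c; split=> // y yn Sy ey.
      have : y = 0 \/ y = b.-1 \/ y = k \/ y = k.+1 - b.
        by rewrite /S /e in Sy ey *; lia.
      by case=> [->|[->|[->|->]]] //; rewrite -f0.
    have [kb2|kb2] := eqVneq k.+2 b.-1.
      have [c [c4 c1 c2 c3]] := avoid3 (f k) (f b.-1) (f y1).
      exists c; split=> // y yn Sy ey.
      have : y = k \/ y = b.-1 \/ y = y1.
        by rewrite /S /e /y1 in Sy ey *; case: ifP; lia.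
      by case=> [->|[->|->]].
    have [c [c4 c1 c2 c3]] := avoid3 (f k) (f y1) (f y2).
    exists c; split=> // y yn Sy ey.
    have : y = k \/ y = y1 \/ y = y2.
      by rewrite /S /e /y1 /y2 in Sy ey *; do 2 case: ifP; lia.
    by case=> [->|[->|->]].
  exists (fun x => if x == k.+1 then c else f x); split.
  - by move=> x; case: ifP.
  - by rewrite !ifN //; lia.
  - move=> x y xn yn Sx Sy exy.
    have [xk|xk] := eqVneq x k.+1; have [yk|yk] := eqVneq y k.+1.
    + by rewrite /e in exy; lia.
    + by apply: cP; [| rewrite /S in Sy *; lia | right; rewrite -xk].
    + by apply: nesym; apply: cP; [| rewrite /S in Sx *; lia | left; rewrite -yk].
    + by apply: fP => //; rewrite /S in Sx Sy *; lia.
have [|f [f4 _ fP]] := greedy n.-1; first lia.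
apply: (@cyc_colorable_window n 1 b f) => //; try lia.
move=> x y xn yn h; apply: fP => //; rewrite /S /e; try lia.
by case: h; tauto.
Qed.

Lemma cyc_colorable_coprime n a b : odd n -> n != 5 -> coprime a n -> ~~ (n %| b) ->
  cyc_colorable n a b.
Proof.
move=> on n5 co nb; have n0 : 0 < n by case: n on {n5 co nb}.
have [u uP] := modn_inverse n0 co.
have cou : coprime n u.
  by have : coprime (u * a) n by [rewrite -coprime_modl uP coprime_modl coprime1n];
     rewrite coprimeMl coprime_sym => /andP[].
apply: (@cyc_colorable_mul u); apply: (@cyc_colorable_mod n 1 ((u * b) %% n)) => //.
  by rewrite modn_mod.
have : (u * b) %% n != 0 by rewrite -/(dvdn _ _) Gauss_dvdr.
have : (u * b) %% n < n by rewrite ltn_mod.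
move: ((u * b) %% n) => c cn c0.
have small d : 0 < d -> d.*2 <= n -> cyc_colorable n 1 d.
  case: d => [|[|[|d]]] // _ dn.
  - apply: cyc_colorable_1_1 => //; lia.
  - apply: cyc_colorable_1_2; move: on n5; clear - dn; lia.
  - exact: cyc_colorable_1_ge3.
(* Steps [c] and [n - c] give the same edges, so the smaller one may be used. *)
have [cle|cgt] := leqP c.*2 n; first by apply: small; lia.
by apply: cyc_colorable_opp; [lia | apply: small; lia].
Qed.

(** * The upper bound for arbitrary steps *)

Lemma coprime_div_gcdn m n : 0 < n -> coprime (m %/ gcdn m n) (n %/ gcdn m n).
Proof.
move=> n0; have g0 : 0 < gcdn m n by rewrite gcdn_gt0 n0 orbT.
by rewrite /coprime -(eqn_pmul2r g0) muln_gcdl !divnK ?dvdn_gcdl ?dvdn_gcdr // mul1n.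
Qed.

(** For [g = gcdn c n], the parity of [x %/ g] has period [n] as [n %/ g] is even, and flips under
    [c] as [c %/ g], coprime to [n %/ g], is odd. The two parities for [a] and [b] together encode
    four colours. *)
Lemma cyc_colorable_even n a b : 0 < n ->
  ~~ odd (n %/ gcdn a n) -> ~~ odd (n %/ gcdn b n) -> cyc_colorable n a b.
Proof.
move=> n0 ea eb.
have half c : ~~ odd (n %/ gcdn c n) -> exists h : nat -> bool,
    (forall x, h (x + n) = h x) /\ forall x, h (x + c) = ~~ h x.
  move=> ec; set g := gcdn c n in ec; have g0 : 0 < g by rewrite gcdn_gt0 n0 orbT.
  have gn : g %| n by rewrite dvdn_gcdr.
  have gc : g %| c by rewrite dvdn_gcdl.
  have oc : odd (c %/ g).
    have := coprime_div_gcdn c n0; rewrite -/g.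
    by apply: contraTT => ec'; rewrite /coprime; apply/negP => /eqP g1;
       have : 2 %| gcdn (c %/ g) (n %/ g) by [rewrite dvdn_gcd !dvdn2 ec ec'];
       rewrite g1.
  exists (fun x => odd (x %/ g)); split=> x; rewrite divnDr // oddD.
    by rewrite (negbTE ec) addbF.
  by rewrite oc addbT.
have [h [hn hc]] := half a ea; have [k [kn kc]] := half b eb.
exists (fun x => h x + 2 * k x); split=> x.
- by case: (h x); case: (k x).
- by rewrite hn kn.
- by rewrite hc; case: (h x); case: (k x); case: (k _).
- by rewrite kc; case: (h x); case: (k x); case: (h _).
Qed.

Lemma cyc_colorable_odd n a b : 0 < n -> ~~ (5 %| n) -> ~~ (n %| a) -> ~~ (n %| b) ->
  odd (n %/ gcdn a n) -> cyc_colorable n a b.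
Proof.
move=> n0; set d := gcdn (gcdn a b) n.
have d0 : 0 < d by rewrite gcdn_gt0 n0 orbT.
have [dab dn] : d %| gcdn a b /\ d %| n by rewrite dvdn_gcdl dvdn_gcdr.
have [a' aE] : exists a', a = d * a'.
  by exists (a %/ d); rewrite mulnC divnK // (dvdn_trans dab) // dvdn_gcdl.
have [b' bE] : exists b', b = d * b'.
  by exists (b %/ d); rewrite mulnC divnK // (dvdn_trans dab) // dvdn_gcdr.
have [m nE] : exists m, n = d * m by exists (n %/ d); rewrite mulnC divnK.
have co : gcdn (gcdn a' b') m = 1.
  by apply/eqP; rewrite -(eqn_pmul2l d0) !muln_gcdr muln1 -aE -bE -nE.
have m0 : 0 < m by move: n0; rewrite nE muln_gt0 => /andP[].
clearbody d; rewrite {}nE {}aE {}bE in n0 dab dn *.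
rewrite -muln_gcdr divnMl // !dvdn_pmul2l // => n5 ma mb oL.
have {n5} m5 : ~~ (5 %| m) by apply: contra n5; apply: dvdn_mull.
apply: cyc_colorable_scale => //.
have g0 : 0 < gcdn a' m by rewrite gcdn_gt0 m0 orbT.
have [g1|g1] := eqVneq (gcdn a' m) 1.
  rewrite g1 divn1 in oL; apply: cyc_colorable_coprime => //.
    by apply: contraNneq m5 => ->.
  by apply/eqP.
have gm := dvdn_gcdr a' m; have ga := dvdn_gcdl a' m.
(* With [g = gcdn a' m], write [m = g * L]: [L] is odd by [oL], exceeds 1 since [m] does not divide
   [a'], and [b'] is coprime to [g] by [co]. *)
rewrite -[m](divnK gm) -[a' in cyc_colorable _ a'](divnK ga).
rewrite ![_ * gcdn a' m]mulnC; apply: cyc_colorable_rows => //.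
- rewrite ltn_neqAle eq_sym divn_gt0 // dvdn_leq // andbT.
  by apply: contra ma => /eqP h; rewrite -[m](divnK gm) h mul1n.
- by rewrite ltn_neqAle eq_sym g1.
- exact: coprime_div_gcdn.
- by rewrite /coprime gcdnA [gcdn b' _]gcdnC co.
Qed.

Lemma cyc_colorableP n a b : 0 < n -> ~~ (5 %| n) -> ~~ (n %| a) -> ~~ (n %| b) ->
  cyc_colorable n a b.
Proof.
move=> n0 n5 na nb.
have [oa|ea] := boolP (odd (n %/ gcdn a n)); first exact: cyc_colorable_odd.
have [ob|eb] := boolP (odd (n %/ gcdn b n)).
  by apply: cyc_colorableC; apply: cyc_colorable_odd.
exact: cyc_colorable_even.
Qed.

(** * From periodic colourings to the chromatic number *)

Lemma colorable_dist_graph n a b (D : {pred nat}) :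
  {subset D <= [:: a; b]} -> cyc_colorable n a b -> colorable (dist_graph n D) 4.
Proof.
move=> Dab [f [f4 fn fa fb]]; apply/existsP; exists [ffun i : 'I_n => Ordinal (f4 i)].
apply/forallP => i; apply/forallP => j; apply/implyP => /andP[_ /Dab].
rewrite !ffunE -val_eqE /= !inE => dij; apply/eqP => fij.
(* At distance [c], one endpoint is the other plus [c], up to one wrap by [n] that periodicity
   absorbs. *)
have key c : f (i + c) <> f i -> f (j + c) <> f j -> cycle_dist i j <> c.
  rewrite /cycle_dist /absdiff => fi fj cE.
  have := ltn_ord i; have := ltn_ord j => jn i_n.
  have : [\/ val j = i + c, val i = j + c, j + n = i + c | i + n = j + c].
    have : val j = i + c \/ val i = j + c \/ j + n = i + c \/ i + n = j + c.
      by rewrite /=; lia.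
    by case=> [|[|[|]]] h; [constructor 1|constructor 2|constructor 3|constructor 4].
  case=> h; [have := fi | have := fj | have := fi | have := fj];
    by rewrite -h ?fn /= fij.
by case/orP: dij => /eqP; apply: key.
Qed.

Lemma chi_le4 n (D : {set 'I_(n./2).+1}) : 0 < n -> ~~ (5 %| n) ->
  D \subset [set d : 'I_(n./2).+1 | 0 < d] -> #|D| == 2 ->
  chi n [in [seq val d | d in D]] <= 4.
Proof.
move=> n0 n5 /subsetP D0 /cards2P[a [b [_ DE]]].
rewrite /chi /chromatic_number; case: ex_minnP => k _; apply.
apply: (@colorable_dist_graph n a b).
  move=> x /imageP[d]; rewrite DE !inE => h ->.
  by case/orP: h => /eqP ->; rewrite eqxx ?orbT.
have ndvd (c : 'I_(n./2).+1) : c \in D -> ~~ (n %| c).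
  move=> /D0; rewrite inE => c0; apply/negP => /dvdn_leq; have := ltn_ord c; lia.
by apply: cyc_colorableP => //; apply: ndvd; rewrite DE !inE eqxx ?orbT.
Qed.

(** * The lower bound and the conclusion *)

(* Three colours on the steps m, 2m force period 3m, hence period m since 3 is
   invertible modulo p. *)
Lemma cyc_3color_absurd m p (f : nat -> nat) : 0 < p -> coprime 3 p ->
  (forall x, f x < 3) -> (forall x, f (x + p * m) = f x) ->
  (forall x, f (x + m) <> f x) -> ~ (forall x, f (x + m.*2) <> f x).
Proof.
move=> p0 co f3 fp fm f2m.
have f3m x : f (x + 3 * m) = f x.
  (* The colours at [x, x + m, x + 2m] are all distinct, as are those at [x + m, x + 2m, x + 3m];
     hence the two ends agree. *)
  have := fm x; have := f2m x; have := fm (x + m); have := f2m (x + m).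
  have := fm (x + m.*2); have -> : x + m + m = x + m.*2 by lia.
  have -> : x + m + m.*2 = x + 3 * m by lia.
  have -> : x + m.*2 + m = x + 3 * m by lia.
  by have := f3 x; have := f3 (x + m); have := f3 (x + m.*2); have := f3 (x + 3 * m); lia.
have [k kP] := modn_inverse p0 co.
apply: (fm 0); rewrite add0n.
have <- : f (k * 3 * m) = f m.
  by apply: (periodic_mod fp); rewrite -muln_modl kP muln_modl mul1n.
by elim: k {kP} => // k IHk; rewrite -IHk -[RHS]f3m; congr f; lia.
Qed.

Lemma chi_ge4 m p (D : {pred nat}) : 0 < m -> 6 < p -> coprime 3 p ->
  m \in D -> m.*2 \in D -> 4 <= chi (p * m) D.
Proof.
move=> m0 p6 co Dm D2m; rewrite /chi /chromatic_number; case: ex_minnP => k.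
case/existsP=> c /forallP cP _; rewrite leqNgt; apply/negP => k4.
set n := p * m in c cP *; have n7 : 7 * m <= n by rewrite leq_mul2r p6 orbT.
have n0 : 0 < n by lia.
pose o x := Ordinal (ltn_pmod x n0).
(* The bound [d.*2 <= n] makes [d], rather than [n - d], the cyclic distance; for [d = 2m] it
   follows from [n7]. *)
have step d x : d \in D -> 0 < d -> d.*2 <= n -> c (o (x + d)) <> c (o x).
  move=> Dd d0 dn; apply/eqP; rewrite eq_sym.
  move/forallP: (cP (o x)) => /(_ (o (x + d)))/implyP; apply.
  have : (x + d) %% n = x %% n + d \/ (x + d) %% n + n = x %% n + d.
    rewrite -modnDml; have := ltn_pmod x n0; move: (x %% n) => r rn.
    have [h|h] := ltnP (r + d) n; first by left; rewrite modn_small.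
    right; have -> : (r + d) %% n = r + d - n.
      by rewrite -[in LHS](subnK h) modnDr modn_small //; lia.
    by lia.
  rewrite /= /dist_adj /cycle_dist /absdiff -val_eqE /=.
  have := ltn_pmod x n0; have := ltn_pmod (x + d) n0.
  move: (x %% n) ((x + d) %% n) => r t tn rn h.
  apply/andP; split; first by apply/eqP; lia.
  by have -> : minn (r - t + (t - r)) (n - (r - t + (t - r))) = d by lia.
apply: (@cyc_3color_absurd m p (fun x => c (o x))) => //=; first lia.
- by move=> x; apply: leq_trans (ltn_ord (c (o x))) _; rewrite -ltnS.
- move=> x; congr (val (c _)); apply: val_inj; by rewrite /= modnDr.
- by move=> x /val_inj; apply: step => //; lia.
- by move=> x /val_inj; apply: step => //; lia.
Qed.

Theorem theorem3p3p2 (n : nat) (n_ge4 : 4 <= n) (n_not5 : ~~ (5 %| n))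
  (n_div : exists p : nat, [/\ prime p, odd p, p != 3 & p %| n]) :
  B2 n = 4.
Proof.
have n0 : 0 < n by lia.
apply/eqP; rewrite eqn_leq; apply/andP; split.
  by apply/bigmax_leqP => D /andP[D0 D2]; apply: chi_le4.
case: n_div => p [p_pr p_odd p3 p_n].
have p5 : p != 5 by apply: contraNneq n_not5 => <-.
have p7 : 6 < p.
  by move: p p_pr p_odd p3 p5 {p_n}; do 7 (case=> //).
have co : coprime 3 p by rewrite prime_coprime // dvdn_prime2 // eq_sym.
(* The step [m] generates the subgroup of order [p] in Z_n. *)
pose m := n %/ p; have nE : n = p * m by rewrite mulnC divnK.
have m0 : 0 < m by move: n0; rewrite nE muln_gt0 => /andP[].
have n7 : 7 * m <= n by rewrite nE leq_mul2r p7 orbT.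
have m1 : m < (n./2).+1 by lia.
have m2 : m.*2 < (n./2).+1 by lia.
pose D := [set Ordinal m1; Ordinal m2].
have chiD : 4 <= chi n [in [seq val d | d in D]].
  rewrite [in chi n]nE; apply: chi_ge4 => //.
  - by apply/imageP; exists (Ordinal m1); rewrite // !inE eqxx.
  - by apply/imageP; exists (Ordinal m2); rewrite // !inE eqxx orbT.
apply: leq_trans chiD _; apply: (@leq_bigmax_cond _ _ _ D).
rewrite cards2 -val_eqE /= (_ : m != m.*2); last lia.
rewrite andbT; apply/subsetP => d; rewrite !inE => /orP[] /eqP -> /=; lia.
Qed.
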